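(* Let $\mathbb{X}$ be a real ordered vector space, $x,y\in\mathbb{X}$ with $x\le y$, and let $\mathbb{Y}$ be an absolute order unit space having vector lattice structure which is Dedekind complete. Let $\mathcal{BV}$ be the space of all functions $[x,y]\to\mathbb{Y}$ of bounded variation and $\mathcal{BV}_0^+$ the set of monotonically increasing $f\in\mathcal{BV}$ with $f([x,y])\subseteq\mathbb{Y}^+$. For $f\in\mathcal{BV}$ write $$\|f\|=\inf_{g\in\mathcal{BV}_0^+}\{\|g\|_\infty: g\pm f\in\mathcal{BV}_0^+\}.$$ Then $(\mathcal{BV},\|\cdot\|)$, ordered by the cone $\mathcal{BV}_0^+$, is an ordered normed space.
   Context: A real ordered vector space is a real vector space $\mathbb{V}$ with a cone $\mathbb{V}^+$ (non-empty, closed under addition and under multiplication by non-negative reals); $u\le v$ means $v-u\in\mathbb{V}^+$, and $u<v$ means $u\le v$ and $u\neq v$. An ordered normed space is a real ordered vector space equipped with a norm. For $x\le y$ in $\mathbb{X}$, $[x,y]=\{z\in\mathbb{X}: x\le z\le y\}$. A partition $\mathcal{P}$ of $[x,y]$ is a finite chain $x=x_0<x_1<\cdots<x_{n_{\mathcal P}}=y$ of points of $[x,y]$. A function $f:[x,y]\to\mathbb{Y}$ is of bounded variation if $\sup\{\sum_{i=1}^{n_{\mathcal P}}|f(x_i)-f(x_{i-1})|:\mathcal P \text{ a partition of }[x,y]\}$ exists in $\mathbb{Y}$. A function $h$ is monotonically increasing if $z_1\le z_2$ implies $h(z_1)\le h(z_2)$. $\|g\|_\infty=\sup_{z\in[x,y]}\|g(z)\|$,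 with $\|\cdot\|$ on $\mathbb{Y}$ the order unit norm. An absolutely ordered space is a real ordered vector space $(\mathbb{V},\mathbb{V}^+)$ with a map $|\cdot|:\mathbb{V}\to\mathbb{V}^+$ such that: (a) $|u|=u$ for $u\in\mathbb{V}^+$; (b) $|u|\pm u\in\mathbb{V}^+$ for all $u$; (c) $|\alpha u|=|\alpha||u|$ for all $u\in\mathbb{V},\alpha\in\mathbb{R}$; (d) if $|u-v|=u+v$ and $0\le w\le v$, then $|u-w|=u+w$; (e) if $|u-v|=u+v$ and $|u-w|=u+w$, then $\big|u-|v\pm w|\big|=u+|v\pm w|$. An element $e\in\mathbb{V}^+$ is an order unit if for each $v$ there is $\epsilon>0$ with $\epsilon e\pm v\in\mathbb{V}^+$; when $\mathbb{V}^+$ is proper ($\mathbb{V}^+\cap-\mathbb{V}^+=\{0\}$) and Archimedean ($\epsilon w+v\in\mathbb{V}^+$ for all $\epsilon>0$ and a fixed $w\in\mathbb{V}^+$ implies $v\in\mathbb{V}^+$), the order unit norm is $\|v\|=\inf\{\epsilon>0:\epsilon e\pm v\in\mathbb{V}^+\}$. For $u,v\in\mathbb{V}^+$: $u\perp v$ means $|u-v|=u+v$; $u\perp_\infty v$ means $\|\alpha u+\beta v\|=\max\{\|\alpha u\|,\|\beta v\|\}$ for all real $\alpha,\beta$; $u\perp_\infty^a v$ means $u_1\perp_\infty v_1$ whenever $0\le u_1\le u$, $0\le v_1\le v$. An absolute order unit space is an absolutely ordered space with an order unit norm determined by an order unit $e$, norm-closed $\mathbb{V}^+$, and $\perp=\perp_\infty^a$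 on $\mathbb{V}^+$. ''Having vector lattice structure'' means $\mathbb{Y}$ is a vector lattice with $|u|=u\vee(-u)$; it is Dedekind complete if every non-empty subset that is bounded above has a supremum. *)

(* Defs.v *)
From HB Require Import structures.
From mathcomp Require Import all_boot all_order all_algebra.
From mathcomp Require Import boolp classical_sets functions reals ereal.
From mathcomp Require Import topology normedtype.

Set Implicit Arguments.
Unset Strict Implicit.
Unset Printing Implicit Defensive.

Import Order.TTheory GRing.Theory Num.Theory.
Import numFieldNormedType.Exports.

Local Open Scope classical_set_scope.
Local Open Scope ring_scope.

Section Cones.
Variables (R : realType) (V : lmodType R).
Implicit Types (C S : set V) (u v w : V).

(* A cone need not be proper, so [cone_le] is only a preorder in general. *)
Record is_cone C : Prop := IsCone {
  cone_nonempty : C !=set0 ;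
  cone_add : forall u v, C u -> C v -> C (u + v) ;
  cone_scale : forall (a : R) u, 0 <= a -> C u -> C (a *: u) }.

Definition cone_le C u v : Prop := C (v - u).

Definition cone_lt C u v : Prop := cone_le C u v /\ u <> v.

Definition cone_itv C u v : set V :=
  [set w | cone_le C u w /\ cone_le C w v].

Definition proper_cone C : Prop := forall u, C u -> C (- u) -> u = 0.

Definition archimedean_cone C : Prop :=
  forall w v, C w -> (forall eps : R, 0 < eps -> C (eps *: w + v)) -> C v.

Definition cone_is_sup C S s : Prop :=
  (forall u, S u -> cone_le C u s) /\
  (forall t, (forall u, S u -> cone_le C u t) -> cone_le C s t).

Definition cone_is_inf C S s : Prop :=
  (forall u, S u -> cone_le C s u) /\
  (forall t, (forall u, S u -> cone_le C t u) -> cone_le C t s).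

Definition dedekind_complete C : Prop :=
  forall S, S !=set0 -> (exists b, forall u, S u -> cone_le C u b) ->
    exists s, cone_is_sup C S s.

Record vector_lattice_structure C (abs : V -> V) : Prop :=
  VectorLatticeStructure {
    lattice_sup : forall u v, exists s, cone_is_sup C [set u; v] s ;
    lattice_inf : forall u v, exists s, cone_is_inf C [set u; v] s ;
    lattice_abs : forall u, cone_is_sup C [set u; - u] (abs u) }.

Record absolutely_ordered_space C (abs : V -> V) : Prop :=
  AbsolutelyOrderedSpace {
    aos_cone : is_cone C ;
    aos_abs_pos : forall u, C (abs u) ;
    aos_abs_id : forall u, C u -> abs u = u ;
    aos_abs_ge : forall u, C (abs u + u) /\ C (abs u - u) ;
    aos_absZ : forall (a : R) u, abs (a *: u) = `|a| *: abs u ;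
    aos_abs_le : forall u v w, abs (u - v) = u + v ->
      C w -> cone_le C w v -> abs (u - w) = u + w ;
    aos_abs_add : forall u v w, abs (u - v) = u + v -> abs (u - w) = u + w ->
      abs (u - abs (v + w)) = u + abs (v + w) /\
      abs (u - abs (v - w)) = u + abs (v - w) }.

Definition order_unit C (e : V) : Prop :=
  C e /\ forall v, exists2 eps : R, 0 < eps &
    C (eps *: e + v) /\ C (eps *: e - v).

Definition order_unit_norm C (e v : V) : R :=
  inf [set eps : R | 0 < eps /\ C (eps *: e + v) /\ C (eps *: e - v)].

(* [W] is a linear subspace of the ambient space [V], [C] a cone of [W], and
   [N] a norm on [W].  [N] is extended-real valued because it will be an
   infimum; that it is finite on [W] is part of being a norm. *)
Record is_ordered_normed_space (W C : set V) (N : V -> \bar R) : Prop :=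
  IsOrderedNormedSpace {
    ons_subspace : submod_closed [in W] ;
    ons_cone_sub : C `<=` W ;
    ons_cone : is_cone C ;
    ons_norm_fin : forall u, W u -> N u \is a fin_num ;
    ons_norm_ge0 : forall u, W u -> (0 <= N u)%E ;
    ons_norm_eq0 : forall u, W u -> N u = 0%E -> u = 0 ;
    ons_normZ : forall (a : R) u, W u -> N (a *: u)%R = (`|a|%:E * N u)%E ;
    ons_normD : forall u v, W u -> W v -> (N (u + v)%R <= N u + N v)%E }.

End Cones.

Section AbsoluteOrderUnit.
Variables (R : realType) (Y : normedModType R).
Variables (C : set Y) (abs : Y -> Y) (e : Y).
Implicit Types u v : Y.

Definition abs_orthogonal u v : Prop := abs (u - v) = u + v.

Definition infty_orthogonal u v : Prop := forall a b : R,
  `|a *: u + b *: v| = Num.max `|a *: u| `|b *: v|.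

Definition absolutely_infty_orthogonal u v : Prop := forall u1 v1,
  C u1 -> cone_le C u1 u -> C v1 -> cone_le C v1 v -> infty_orthogonal u1 v1.

(* The norm carried by [Y] is required to be the order unit norm of [e]. *)
Record absolute_order_unit_space : Prop := AbsoluteOrderUnitSpace {
  aous_aos : absolutely_ordered_space C abs ;
  aous_proper : proper_cone C ;
  aous_archimedean : archimedean_cone C ;
  aous_unit : order_unit C e ;
  aous_norm : forall v, `|v| = order_unit_norm C e v ;
  aous_closed : closed C ;
  aous_orthogonal : forall u v, C u -> C v ->
    (abs_orthogonal u v <-> absolutely_infty_orthogonal u v) }.

End AbsoluteOrderUnit.

Section BoundedVariation.
Variables (R : realType) (X : lmodType R) (Xp : set X) (x y : X).
Variables (Y : normedModType R) (Yp : set Y) (abs : Y -> Y).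

Local Notation I := (set_type (cone_itv Xp x y)).
Implicit Types f g : I -> Y.

(* The chain p 0 < ... < p n; values of [p] beyond [n] are irrelevant.
   [n = 0] is allowed, which is needed when x = y. *)
Definition is_partition (n : nat) (p : nat -> I) : Prop :=
  [/\ val (p 0) = x, val (p n) = y &
      forall i, (i < n)%N -> cone_lt Xp (val (p i)) (val (p i.+1))].

Definition partition_variation f (n : nat) (p : nat -> I) : Y :=
  \sum_(i < n) abs (f (p i.+1) - f (p i)).

Definition BV : set (I -> Y) := [set f | exists s : Y,
  cone_is_sup Yp
    [set t | exists n p, is_partition n p /\ t = partition_variation f n p] s].

Definition monotonically_increasing f : Prop :=
  forall z1 z2 : I, cone_le Xp (val z1) (val z2) -> cone_le Yp (f z1) (f z2).

Definition BV0p : set (I -> Y) :=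
  [set f | [/\ BV f, monotonically_increasing f & forall z, Yp (f z)]].

Definition sup_norm g : \bar R := ereal_sup [set `|g z|%:E | z in [set: I]].

Definition BV_norm f : \bar R :=
  ereal_inf [set sup_norm g | g in
    [set g | [/\ BV0p g, BV0p (g + f) & BV0p (g - f)]]].

End BoundedVariation.

(* Main.v *)
Require Import Defs.
From mathcomp Require Import all_boot all_order all_algebra.
From mathcomp Require Import boolp classical_sets functions reals ereal.
From mathcomp Require Import topology normedtype.

(** Call [g] a majorant of [f] when [g], [g + f] and [g - f] are all increasing
    and positive; the norm of [f] is the infimum of the sup norms of its
    majorants.  Two facts carry the proof.

    Majorants exist (Jordan decomposition).  By Dedekind completeness, a
    function [f] of bounded variation has a variation [v z] along the chains
    from [x] to [z].  A chain to [z1] can be prolonged to any larger [z2], so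
    [|f z2 - f z1| <= v z2 - v z1]; hence [|f x| + v] is a majorant of [f]
    ([majorant_exists]), and the norm of [f] is finite.  Conversely an
    increasing function telescopes along chains, so it has bounded variation,
    and membership in the cone amounts to being increasing and positive
    ([BV0pP]).

    Sup norms are values at one point.  The order unit norm is monotone
    ([order_unit_norm_le]), so a positive increasing [g] has sup norm
    [`|g y|] ([sup_norm_increasing]).  Thus the norm of [f] is the infimum of
    [`|g y|] over the majorants [g].  As [- g <= f <= g], this infimum is at
    least [`|f z|] for every [z], which gives definiteness.  Majorants can be
    added and scaled, which gives the triangle inequality and homogeneity. *)

Set Implicit Arguments.
Unset Strict Implicit.
Unset Printing Implicit Defensive.

Import Order.TTheory GRing.Theory Num.Theory.

Local Open Scope classical_set_scope.
Local Open Scope ring_scope.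

(** * Order and absolute value in a vector space with a cone *)

Section ConeOrder.
Context {R : realType} {V : lmodType R} {C : set V} (hC : is_cone C).
Implicit Types u v w : V.

Lemma cone0 : C 0.
Proof.
have [u Cu] := cone_nonempty hC.
by rewrite -(scale0r u); exact: (cone_scale hC).
Qed.

Lemma cone_le_refl u : cone_le C u u.
Proof. by rewrite /cone_le subrr; exact: cone0. Qed.

Lemma cone_le_trans v u w : cone_le C u v -> cone_le C v w -> cone_le C u w.
Proof.
move=> uv vw; rewrite /cone_le -(subrK v w) -addrA.
exact: (cone_add hC).
Qed.

Lemma cone_leD u v u' v' :
  cone_le C u v -> cone_le C u' v' -> cone_le C (u + u') (v + v').
Proof. by move=> uv uv'; rewrite /cone_le opprD addrACA; exact: (cone_add hC). Qed.

Lemma cone_leZ (a : R) u v :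
  0 <= a -> cone_le C u v -> cone_le C (a *: u) (a *: v).
Proof. by move=> a0 uv; rewrite /cone_le -scalerBr; exact: (cone_scale hC). Qed.

Lemma cone_le_addr u v : C v -> cone_le C u (u + v).
Proof. by rewrite /cone_le addrAC subrr add0r. Qed.

Lemma cone_le_sum n (F G : 'I_n -> V) : (forall i, cone_le C (F i) (G i)) ->
  cone_le C (\sum_(i < n) F i) (\sum_(i < n) G i).
Proof.
move=> FG; apply: (big_ind2 (cone_le C)) => //; first exact: cone_le_refl.
by move=> u v u' v'; exact: cone_leD.
Qed.

(** [abs u + abs v] is an upper bound of [u + v] and [- (u + v)], and
    [abs (u + v)] is the least one. *)
Lemma lattice_absD (abs : V -> V) u v :
  (forall w, cone_is_sup C [set w; - w] (abs w)) ->
  cone_le C (abs (u + v)) (abs u + abs v).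
Proof.
move=> habs; have [_ leastD] := habs (u + v); apply: leastD.
have [ubu _] := habs u; have [ubv _] := habs v.
move=> w [->|->].
- by apply: cone_leD; [apply: ubu|apply: ubv]; left.
- by rewrite opprD; apply: cone_leD; [apply: ubu|apply: ubv]; right.
Qed.

(** Every [eps] that is admissible for [v] is admissible for [u]. *)
Lemma order_unit_norm_le (e u v : V) : order_unit C e ->
  C (v + u) -> C (v - u) -> order_unit_norm C e u <= order_unit_norm C e v.
Proof.
move=> [_ he] Cvu CvNu; apply: lb_le_inf.
  by have [eps eps0 [? ?]] := he v; exists eps.
move=> eps [eps0 [_ CepsNv]]; apply: ge_inf.
  by exists 0 => r [/ltW].
split=> //; split.
- by rewrite -(subrK v (_ *: e)) -addrA; exact: (cone_add hC).
- by rewrite -(subrK v (_ *: e)) -addrA; exact: (cone_add hC).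
Qed.

End ConeOrder.

(** * Variation, majorants and the Jordan decomposition *)

Section Jordan.
Context {R : realType} {X : lmodType R} {Xp : set X} {x y : X}.
Context {Y : normedModType R} {Yp : set Y} {abs : Y -> Y}.
Hypotheses (hX : is_cone Xp) (hxy : cone_le Xp x y).
Hypotheses (hA : absolutely_ordered_space Yp abs).
Hypothesis habs : forall u, cone_is_sup Yp [set u; - u] (abs u).
Hypothesis hded : dedekind_complete Yp.

Local Notation I := (set_type (cone_itv Xp x y)).
Local Notation BV := (@BV R X Xp x y Y Yp abs).
Local Notation BV0p := (@BV0p R X Xp x y Y Yp abs).
Local Notation increasing := (@monotonically_increasing R X Xp x y Y Yp).
Local Notation variation := (@partition_variation R X Xp x y Y abs).
Implicit Types (f g : I -> Y) (z : I).

Let hY : is_cone Yp := aos_cone hA.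

Lemma itv_left_mem : cone_itv Xp x y x.
Proof. by split=> //; exact: cone_le_refl. Qed.

Lemma itv_right_mem : cone_itv Xp x y y.
Proof. by split=> //; exact: cone_le_refl. Qed.

Definition itv_left : I := exist _ x (mem_set itv_left_mem).
Definition itv_right : I := exist _ y (mem_set itv_right_mem).

Lemma itv_left_le z : cone_le Xp (val itv_left) (val z).
Proof. by case: z => z /= /set_mem[]. Qed.

Lemma itv_right_ge z : cone_le Xp (val z) (val itv_right).
Proof. by case: z => z /= /set_mem[]. Qed.

Lemma abs0 : abs 0 = 0.
Proof. by apply: (aos_abs_id hA); exact: cone0. Qed.

Lemma absN u : abs (- u) = abs u.
Proof. by rewrite -scaleN1r (aos_absZ hA) normrN1 scale1r. Qed.

(** At [itv_right] this is, up to conversion, the set of partition sums whose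
    supremum defines bounded variation. *)
Definition chain_sums f z : set Y := [set t | exists n (p : nat -> I),
  [/\ val (p 0) = x, val (p n) = val z &
      forall i, (i < n)%N -> cone_lt Xp (val (p i)) (val (p i.+1))] /\
  t = variation f n p].

Lemma chain_sums_left f : chain_sums f itv_left 0.
Proof.
exists 0, (fun=> itv_left); split; first by split.
by rewrite /partition_variation big_ord0.
Qed.

(** A chain to [z1] is prolonged by the point [z2], unless [z1 = z2], in which
    case the added term vanishes. *)
Lemma chain_sums_extend f z1 z2 t : cone_le Xp (val z1) (val z2) ->
  chain_sums f z1 t -> chain_sums f z2 (t + abs (f z2 - f z1)).
Proof.
move=> z12 [n [p [[p0 pn pS] ->]]].
have [<-|neq] := eqVneq z1 z2.
  by rewrite subrr abs0 addr0; exists n, p.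
exists n.+1, (fun i => if (i <= n)%N then p i else z2); split.
  split=> [//||i]; rewrite ?ltnn // ltnS => le_in; cbv beta; rewrite le_in.
  have [lt_in|ge_in] := ltnP i n; first exact: pS.
  have -> : i = n by apply/eqP; rewrite eqn_leq le_in.
  rewrite pn; split=> // eq12.
  by move/eqP: neq; apply; exact: val_inj.
rewrite /partition_variation big_ord_recr /= leqnn ltnn (val_inj pn).
congr (_ + _); apply: eq_bigr => i _.
by rewrite (ltn_ord i) (ltnW (ltn_ord i)).
Qed.

Lemma chain_sums_nonempty f z : chain_sums f z !=set0.
Proof.
exists (0 + abs (f z - f itv_left)).
by apply: chain_sums_extend (chain_sums_left f); exact: itv_left_le.
Qed.

(** By Dedekind completeness an upper bound is enough, so bounded variation can
    be checked by estimating chain sums, without computing any supremum. *)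
Lemma BVP f : BV f <-> exists b, forall t,
  chain_sums f itv_right t -> cone_le Yp t b.
Proof.
split=> [[s [ub _]]|bounded]; first by exists s.
exact: (hded (chain_sums_nonempty f itv_right) bounded).
Qed.

Lemma variation_linear_le (a : R) f g n p :
  cone_le Yp (variation (a *: f + g) n p)
             (`|a| *: variation f n p + variation g n p).
Proof.
rewrite /partition_variation scaler_sumr -big_split /=.
apply: (cone_le_sum hY) => i; rewrite -(aos_absZ hA) !fctE.
rewrite opprD addrACA -scalerBr.
exact: (lattice_absD hY).
Qed.

Lemma BV_linear (a : R) f g : BV f -> BV g -> BV (a *: f + g).
Proof.
move=> /BVP[b ub] /BVP[b' ub']; apply/BVP; exists (`|a| *: b + b').
move=> _ [n [p [chain ->]]].
apply: (cone_le_trans hY (variation_linear_le a f g n p)).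
by apply: (cone_leD hY); [apply: (cone_leZ hY) => //; apply: ub|apply: ub'];
  exists n, p.
Qed.

Lemma variation_increasing f n p : increasing f ->
  (forall i, (i < n)%N -> cone_lt Xp (val (p i)) (val (p i.+1))) ->
  variation f n p = f (p n) - f (p 0).
Proof.
move=> fI pS; rewrite -(telescope_sumr (fun i => f (p i)) (leq0n n)) big_mkord.
apply: eq_bigr => i _; apply: (aos_abs_id hA).
by have [le_p _] := pS i (ltn_ord i); exact: fI.
Qed.

Lemma BV_increasing f : increasing f -> BV f.
Proof.
move=> fI; apply/BVP; exists (f itv_right - f itv_left).
move=> _ [n [p [[p0 pn pS] ->]]]; rewrite variation_increasing //.
have -> : p n = itv_right by exact: val_inj.
have -> : p 0 = itv_left by exact: val_inj.
exact: (cone_le_refl hY).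
Qed.

Lemma BV0pP f : BV0p f <-> increasing f /\ forall z, Yp (f z).
Proof.
split=> [[_ fI f0] //|[fI f0]].
by split=> //; exact: BV_increasing.
Qed.

Lemma BV0p_is_cone : is_cone BV0p.
Proof.
split.
- exists 0; apply/BV0pP; split=> [z1 z2 _|z]; last exact: (cone0 hY).
  exact: (cone_le_refl hY).
- move=> f g /BV0pP[fI f0] /BV0pP[gI g0]; apply/BV0pP; split=> [z1 z2 z12|z].
    exact: (cone_leD hY (fI _ _ z12) (gI _ _ z12)).
  exact: (cone_add hY).
- move=> a f a0 /BV0pP[fI f0]; apply/BV0pP; split=> [z1 z2 z12|z].
    exact: (cone_leZ hY a0 (fI _ _ z12)).
  exact: (cone_scale hY).
Qed.

(** A chain to [z] prolongs to a chain to [y], so the variation of [f] on all of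
    [[x, y]] bounds the sums of the chains to [z]. *)
Lemma variation_function f : BV f -> exists v : I -> Y,
  forall z, cone_is_sup Yp (chain_sums f z) (v z).
Proof.
move=> /BVP[b ub].
suff /choice[v hv] : forall z, exists s, cone_is_sup Yp (chain_sums f z) s.
  by exists v.
move=> z; apply: hded; first exact: chain_sums_nonempty.
exists b => t /(chain_sums_extend (itv_right_ge z))/ub.
by apply: (cone_le_trans hY); apply: cone_le_addr; exact: (aos_abs_pos hA).
Qed.

Lemma variation_function_increment f v :
  (forall z, cone_is_sup Yp (chain_sums f z) (v z)) ->
  forall z1 z2, cone_le Xp (val z1) (val z2) ->
  cone_le Yp (abs (f z2 - f z1)) (v z2 - v z1).
Proof.
move=> hv z1 z2 z12; have [ub2 _] := hv z2; have [_ least1] := hv z1.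
suff: cone_le Yp (v z1) (v z2 - abs (f z2 - f z1)) by rewrite /cone_le addrAC.
apply: least1 => t /(chain_sums_extend z12)/ub2.
by rewrite /cone_le opprD addrA addrAC.
Qed.

Definition majorants f : set (I -> Y) :=
  [set g | [/\ BV0p g, BV0p (g + f) & BV0p (g - f)]].

(** [|u| <= w] makes [w + u] positive, since [|u| + u] is.  This applies to the
    increments of the two functions and to their values. *)
Lemma BV0p_add_dominated f g :
  (forall z1 z2, cone_le Xp (val z1) (val z2) ->
    cone_le Yp (abs (f z2 - f z1)) (g z2 - g z1)) ->
  (forall z, cone_le Yp (abs (f z)) (g z)) -> BV0p (g + f).
Proof.
have absDge0 u w : cone_le Yp (abs u) w -> Yp (w + u).
  move=> uw; rewrite -(subrK (abs u) w) -addrA.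
  by apply: (cone_add hY) => //; have [] := aos_abs_ge hA u.
move=> dinc dval; apply/BV0pP; split=> [z1 z2 z12|z]; last exact: absDge0.
by rewrite /cone_le !fctE opprD addrACA; apply: absDge0; exact: dinc.
Qed.

Lemma majorant_dominating f g :
  (forall z1 z2, cone_le Xp (val z1) (val z2) ->
    cone_le Yp (abs (f z2 - f z1)) (g z2 - g z1)) ->
  (forall z, cone_le Yp (abs (f z)) (g z)) -> majorants f g.
Proof.
move=> dinc dval; split.
- have ge_abs u w : cone_le Yp (abs u) w -> Yp w.
    move=> uw; rewrite -(subrK (abs u) w).
    by apply: (cone_add hY) => //; exact: (aos_abs_pos hA).
  apply/BV0pP; split=> [z1 z2 z12|z]; last exact: ge_abs (dval z).
  exact: ge_abs (dinc _ _ z12).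
- exact: BV0p_add_dominated.
- apply: BV0p_add_dominated => [z1 z2 z12|z]; rewrite !fctE.
    by rewrite -opprD absN; exact: dinc.
  by rewrite absN.
Qed.

Lemma majorant_exists f : BV f -> majorants f !=set0.
Proof.
move=> /variation_function[v hv].
have incv := variation_function_increment hv.
exists (fun z => abs (f itv_left) + v z); apply: majorant_dominating.
  move=> z1 z2 z12; rewrite opprD addrACA subrr add0r.
  exact: incv.
move=> z; have zl := itv_left_le z.
(* [f z = f x + (f z - f x)], and [v] is positive at [x]. *)
rewrite -{1}(subrK (f itv_left) (f z)) addrC.
apply: (cone_le_trans hY (lattice_absD hY _ _ habs)).
apply: (cone_leD hY); first exact: (cone_le_refl hY).
apply: (cone_le_trans hY (incv _ _ zl)).
rewrite /cone_le opprB addrCA subrr addr0.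
have [ub _] := hv itv_left.
by have := ub _ (chain_sums_left f); rewrite /cone_le subr0.
Qed.

Lemma majorantsD f f' g g' :
  majorants f g -> majorants f' g' -> majorants (f + f') (g + g').
Proof.
have add := cone_add BV0p_is_cone.
move=> [g0 gf gNf] [g0' gf' gNf']; split; first exact: add.
- by rewrite addrACA; exact: add.
- by rewrite opprD addrACA; exact: add.
Qed.

Lemma majorantsZ (a : R) f g : majorants f g -> majorants (a *: f) (`|a| *: g).
Proof.
have scale := cone_scale BV0p_is_cone.
move=> [g0 gf gNf]; split; first exact: scale.
- have [a0|a0] := ger0P a; first by rewrite -scalerDr; exact: scale.
  rewrite -[a *: f]opprK -scaleNr -scalerBr.
  by apply: scale => //; rewrite oppr_ge0 ltW.
- have [a0|a0] := ger0P a; first by rewrite -scalerBr; exact: scale.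
  rewrite -scaleNr -scalerDr.
  by apply: scale => //; rewrite oppr_ge0 ltW.
Qed.

(** * The norm *)

Section Norm.
(** The norm inequality that [order_unit_norm_le] gives for order unit
    norms. *)
Hypothesis norm_mono : forall u v : Y, Yp (v + u) -> Yp (v - u) -> `|u| <= `|v|.

Local Notation BV_norm := (@BV_norm R X Xp x y Y Yp abs).

Lemma norm_increasing_le g z : BV0p g -> `|g z| <= `|g itv_right|.
Proof.
move=> /BV0pP[gI g0]; apply: norm_mono; first exact: (cone_add hY).
exact: gI (itv_right_ge z).
Qed.

Lemma sup_norm_increasing g : BV0p g -> sup_norm g = `|g itv_right|%:E.
Proof.
move=> g0; apply/eqP; rewrite eq_le; apply/andP; split.
  by apply: ge_ereal_sup => _ [z _ <-]; rewrite lee_fin norm_increasing_le.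
by apply: ereal_sup_ubound; exists itv_right.
Qed.

Lemma BV_norm_le f g : majorants f g -> (BV_norm f <= `|g itv_right|%:E)%E.
Proof.
move=> fg; have [g0 _ _] := fg; rewrite -sup_norm_increasing //.
by apply: ereal_inf_lbound; exists g.
Qed.

Lemma le_BV_norm f (r : \bar R) :
  (forall g, majorants f g -> (r <= `|g itv_right|%:E)%E) -> (r <= BV_norm f)%E.
Proof.
move=> hr; apply: le_ereal_inf_tmp => _ [g fg <-].
by have [g0 _ _] := fg; rewrite sup_norm_increasing //; exact: hr.
Qed.

Lemma norm_le_BV_norm f z : (`|f z|%:E <= BV_norm f)%E.
Proof.
apply: le_BV_norm => g [g0 /BV0pP[_ gf] /BV0pP[_ gNf]]; rewrite lee_fin.
apply: le_trans (norm_increasing_le z g0).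
by apply: norm_mono; [exact: gf|exact: gNf].
Qed.

Lemma BV_norm_ge0 f : (0 <= BV_norm f)%E.
Proof. exact: le_trans (norm_le_BV_norm f itv_right). Qed.

Lemma BV_norm_fin f : BV f -> BV_norm f \is a fin_num.
Proof.
move=> /majorant_exists[g /BV_norm_le fg].
by rewrite ge0_fin_numE ?BV_norm_ge0// (le_lt_trans fg) ?ltry.
Qed.

Lemma BV_norm_eq0 f : BV_norm f = 0%E -> f = 0.
Proof.
move=> f0; apply/funext => z; apply/eqP; rewrite -normr_le0 -lee_fin.
by have := norm_le_BV_norm f z; rewrite f0.
Qed.

Lemma BV_normD f g : BV f -> BV g ->
  (BV_norm (f + g)%R <= BV_norm f + BV_norm g)%E.
Proof.
move=> fBV gBV; rewrite -leeBlDr ?BV_norm_fin//.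
apply: le_BV_norm => f' ff'; rewrite leeBlDr ?BV_norm_fin// -leeBlDl//.
apply: le_BV_norm => g' gg'; rewrite leeBlDl//.
apply: (le_trans (BV_norm_le (majorantsD ff' gg'))).
by rewrite -EFinD lee_fin; exact: ler_normD.
Qed.

Lemma BV_normZ_le (a : R) f : a != 0 ->
  (BV_norm (a *: f)%R <= `|a|%:E * BV_norm f)%E.
Proof.
rewrite -normr_gt0 => a0; rewrite -lee_pdivrMl//.
apply: le_BV_norm => g fg; rewrite lee_pdivrMl//.
apply: (le_trans (BV_norm_le (majorantsZ a fg))).
by rewrite -EFinM lee_fin fctE normrZ normr_id.
Qed.

Lemma BV_norm0 : BV_norm 0 = 0%E.
Proof.
apply/eqP; rewrite eq_le BV_norm_ge0 andbT.
have zero0p : BV0p 0 by exact: (cone0 BV0p_is_cone).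
have : majorants 0 0 by split; rewrite ?subr0 ?addr0.
by move/BV_norm_le; rewrite normr0.
Qed.

(** The reverse inequality is [BV_normZ_le] for the scalar [a^-1]. *)
Lemma BV_normZ (a : R) f : BV_norm (a *: f)%R = (`|a|%:E * BV_norm f)%E.
Proof.
have [->|a0] := eqVneq a 0; first by rewrite scale0r normr0 mul0e BV_norm0.
apply/eqP; rewrite eq_le BV_normZ_le//= -lee_pdivlMl ?normr_gt0//.
rewrite -normfV -{1}(scalerK a0 f).
by apply: BV_normZ_le; rewrite invr_eq0.
Qed.

End Norm.

End Jordan.

Theorem corollary4p7 (R : realType)
  (X : lmodType R) (Xp : set X) (x y : X)
  (Y : normedModType R) (Yp : set Y) (abs : Y -> Y) (e : Y)
  (hX : is_cone Xp) (hxy : cone_le Xp x y)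
  (hY : absolute_order_unit_space Yp abs e)
  (hlat : vector_lattice_structure Yp abs)
  (hded : dedekind_complete Yp) :
  is_ordered_normed_space
    (@BV R X Xp x y Y Yp abs)
    (@BV0p R X Xp x y Y Yp abs)
    (@BV_norm R X Xp x y Y Yp abs).
Proof.
have hA := aous_aos hY; have habs := lattice_abs hlat.
have norm_mono (u v : Y) : Yp (v + u) -> Yp (v - u) -> `|u| <= `|v|.
  rewrite !(aous_norm hY).
  exact (order_unit_norm_le (aos_cone hA) (aous_unit hY)).
have BV0 : @BV R X Xp x y Y Yp abs 0
  by have [] := cone0 (BV0p_is_cone hX hxy hA hded).
split.
- split=> [|a f g]; first exact/mem_set.
  rewrite !inE => fBV gBV.
  exact: (BV_linear hX hxy hA habs hded).
- by move=> f [].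
- exact: (BV0p_is_cone hX hxy hA hded).
- exact: (BV_norm_fin hX hxy hA habs hded norm_mono).
- by move=> f _; exact: (BV_norm_ge0 hX hxy hA hded norm_mono).
- by move=> f _; exact: (BV_norm_eq0 hX hxy hA hded norm_mono).
- by move=> a f _; exact: (BV_normZ hX hxy hA hded norm_mono).
- exact: (BV_normD hX hxy hA habs hded norm_mono).
Qed.
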